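(* Let $l \geq 6$ be an integer and $\tau = \lfloor l/3 \rfloor$. For integers $0 \le j \le \tau$ define $$g_l(j) = \frac{(l+j)^{(2j)}\,(l+j)^{(2j)}}{(l+3j)^{(2j)}\,(l-j)^{(2j)}}, \qquad h_l(j) = \frac{l+j}{l-j},$$ (so $g_l(0)=h_l(0)=1$), and for a function $f$ on $\{0,\dots,\tau\}$ write $\Delta^2 f(j) = f(j+1) - 2f(j) + f(j-1)$ for $1 \le j \le \tau-1$ and $\Delta^3 f(j) = \Delta^2 f(j+1) - \Delta^2 f(j)$ for $1\le j\le \tau-2$. Then: (i) $h_l(j)$ is increasing in $j$ and $\Delta^2 h_l(j) > 0$ for $j = 1, \dots, \tau-1$; (ii) $\Delta^3 h_l(j) > 0$ for $j = 1, \dots, \tau-2$; (iii) $g_l(j)$ is increasing in $j$ and $\Delta^2 g_l(j) > 0$ for $j = 1, \dots, \tau-1$; (iv) $\Delta^3 g_l(j) > 0$ for $j = 1, \dots, \tau-2$; (v) $\Delta^2 g_l(1) > \Delta^2 h_l(\tau-1)$.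
   Context: For a real $x$ and integer $m \ge 0$, $x^{(m)} = x(x-1)\cdots(x-m+1)$ denotes the descending factorial power, with $x^{(0)}=1$. *)

(* Defs.v *)
From mathcomp Require Import all_boot all_order all_algebra.

Set Implicit Arguments.
Unset Strict Implicit.
Unset Printing Implicit Defensive.

Import Order.TTheory GRing.Theory Num.Theory.
Local Open Scope ring_scope.

Definition ffactr (R : realFieldType) (x : R) (m : nat) : R :=
  \prod_(i < m) (x - i%:R).

Definition g (R : realFieldType) (l j : nat) : R :=
  (ffactr (l%:R + j%:R) (2 * j) * ffactr (l%:R + j%:R) (2 * j)) /
  (ffactr (l%:R + (3 * j)%:R) (2 * j) * ffactr (l%:R - j%:R) (2 * j)).

Definition h (R : realFieldType) (l j : nat) : R :=
  (l%:R + j%:R) / (l%:R - j%:R).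

(* Functions on {0, ..., tau} are represented by functions on nat.
   [Delta2 f j] is the central second difference only for j >= 1, since
   0.-1 = 0. *)
Definition Delta2 (R : realFieldType) (f : nat -> R) (j : nat) : R :=
  f j.+1 - 2 * f j + f j.-1.

Definition Delta3 (R : realFieldType) (f : nat -> R) (j : nat) : R :=
  Delta2 f j.+1 - Delta2 f j.

Definition increasing_upto (R : realFieldType) (n : nat) (f : nat -> R) : Prop :=
  forall i j : nat, (i < j <= n)%N -> f i < f j.

Lemma g0 (R : realFieldType) (l : nat) : g R l 0 = 1.
Proof. by rewrite /g /ffactr muln0 !big_ord0 !mulr1 divr1. Qed.

Lemma h0 (R : realFieldType) (l : nat) : (0 < l)%N -> h R l 0 = 1.
Proof. by move=> l_gt0; rewrite /h addr0 subr0 divff // pnatr_eq0 -lt0n. Qed.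

(* Main.v *)
(** Write [N = l + 1/2] and [s = j + 1/2]. The quotient [g (j+1) / g j] is the
    product over [e = -1, 0, 1] of
      [(N^2 - s^2) / (N^2 - (3s+e)^2) = 1 + (2s+e)(4s+e) / (N^2 - (3s+e)^2)],
    and each factor is nonnegative, nondecreasing and convex in [j], because its
    numerator is, and its denominator is positive, decreasing and concave. These
    properties pass to products. For a sequence whose quotients exceed 1, are
    nondecreasing and convex, the first three differences are positive. For [h],
    everything follows from [h j = 2l / (l - j) - 1]. For (v), the factor with
    [e = 1] alone gives [Delta2 g 1 >= 22 / (l (l+1))], whereas
    [Delta2 h (tau-1) <= 27 / ((2l+3) (l+3))]. *)
Require Import Defs.
From mathcomp Require Import all_boot all_order all_algebra.
From mathcomp Require Import zify ring lra.
Import Order.TTheory GRing.Theory Num.Theory.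
Local Open Scope ring_scope.

(** * Monotone sequences and convex triples *)

Lemma increasing_upto_step (R : realFieldType) (n : nat) (f : nat -> R) :
  (forall i, (i < n)%N -> f i < f i.+1) -> increasing_upto n f.
Proof.
move=> f_step i j /andP[]; elim: j => // j IHj; rewrite ltnS leq_eqVlt.
case/orP=> [/eqP<-|lt_ij] lt_jn; first exact: f_step.
exact: lt_trans (IHj lt_ij (ltnW lt_jn)) (f_step _ lt_jn).
Qed.

(** Three consecutive values suffice, since a third difference of [g] involves only three quotients.
    The conditions also force [x1 <= 2 * x1 - x0 <= x2]. *)
Definition convex3 (R : realFieldType) (x0 x1 x2 : R) : Prop :=
  [/\ 0 <= x0, x0 <= x1 & 2 * x1 <= x0 + x2].

(** Convexity bounds [x2 * y2] below by the product of the extrapolations [2 * x1 - x0] and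
    [2 * y1 - y0]; what is then left over is [2 * (x1 - x0) * (y1 - y0)]. *)
Lemma convex3M (R : realFieldType) (x0 x1 x2 y0 y1 y2 : R) :
  convex3 R x0 x1 x2 -> convex3 R y0 y1 y2 ->
  convex3 R (x0 * y0) (x1 * y1) (x2 * y2).
Proof.
move=> [x0_ge0 le_x cx] [y0_ge0 le_y cy]; split.
- exact: mulr_ge0.
- exact: ler_pM.
have le_xy2 : (2 * x1 - x0) * (2 * y1 - y0) <= x2 * y2.
  by apply: ler_pM; lra.
have : 0 <= (x1 - x0) * (y1 - y0) by apply: mulr_ge0; lra.
nra.
Qed.

Lemma convex3D1 (R : realFieldType) (x0 x1 x2 : R) :
  convex3 R x0 x1 x2 -> convex3 R (1 + x0) (1 + x1) (1 + x2).
Proof. by case=> *; split; lra. Qed.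

Lemma convex3V (R : realFieldType) (d0 d1 d2 : R) :
  0 < d0 -> 0 < d1 -> 0 < d2 -> d1 <= d0 -> d0 + d2 <= 2 * d1 ->
  convex3 R d0^-1 d1^-1 d2^-1.
Proof.
move=> d0_gt0 d1_gt0 d2_gt0 le_d cd; split.
- by rewrite invr_ge0 ltW.
- by rewrite lef_pV2.
have -> : d0^-1 + d2^-1 = (d0 + d2) / (d0 * d2).
  by field; rewrite !gt_eqF.
rewrite ler_pdivlMr ?mulr_gt0 // mulrAC ler_pdivrMr //.
(* The goal [2 * (d0 * d2) <= (d0 + d2) * d1] follows from [(d0 + d2) * d1 >= (d0 + d2)^2 / 2 >= 2 *
   d0 * d2]. *)
have sq : 0 <= (d0 - d2) ^+ 2 by exact: sqr_ge0.
have : 0 <= (d0 + d2) * (2 * d1 - (d0 + d2)) by apply: mulr_ge0; lra.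
nra.
Qed.

(** * Differences of a sequence given by its quotients *)

Section QuotientSequences.
Variables (R : realFieldType) (f r : nat -> R) (j : nat).
Hypothesis (f_gt0 : 0 < f j) (r_gt1 : 1 < r j) (r_le : r j <= r j.+1).
Hypothesis fS : f j.+1 = f j * r j.
Hypothesis fSS : f j.+2 = f j.+1 * r j.+1.

(** The second difference exceeds the bound by exactly [f j * (r j - 1) * (r j.+1 - 1)]. The
    explicit bound, not only positivity, serves (v). *)
Lemma Delta2_quotient_ge : f j * (r j.+1 - r j) < Delta2 f j.+1.
Proof.
rewrite /Delta2 /= fSS fS -subr_gt0.
have -> : f j * r j * r j.+1 - 2 * (f j * r j) + f j - f j * (r j.+1 - r j)
          = f j * ((r j - 1) * (r j.+1 - 1)) by ring.
by rewrite !mulr_gt0 // subr_gt0 // (lt_le_trans r_gt1).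
Qed.

Lemma Delta2_quotient_gt0 : 0 < Delta2 f j.+1.
Proof.
apply: le_lt_trans Delta2_quotient_ge.
by apply: mulr_ge0; rewrite ?subr_ge0 // ltW.
Qed.

Hypothesis r_cvx : 2 * r j.+1 <= r j + r j.+2.
Hypothesis fSSS : f j.+3 = f j.+2 * r j.+2.

Lemma Delta3_quotient_gt0 : 0 < Delta3 f j.+1.
Proof.
rewrite /Delta3 /Delta2 /= fSSS fSS fS.
set a0 := r j - 1; set a1 := r j.+1 - 1; set a2 := r j.+2 - 1.
have a0_gt0 : 0 < a0 by rewrite subr_gt0.
have le_a01 : a0 <= a1 by rewrite lerD2r.
have cvx_a : 0 <= a2 - 2 * a1 + a0 by move: r_cvx; rewrite /a0 /a1 /a2; lra.
have le_a12 : a1 <= a2 by lra.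
have le_aa : a0 * a0 <= a1 * a2 by apply: ler_pM; lra.
(* The grouping isolates the convexity of the quotients, then their monotonicity; the cube [a0 ^+ 3]
   gives strictness. *)
have -> : forall u, u * r j * r j.+1 * r j.+2 - 2 * (u * r j * r j.+1)
    + u * r j - (u * r j * r j.+1 - 2 * (u * r j) + u)
  = u * ((1 + a0) * (a2 - 2 * a1 + a0) + (1 + a0) * (a1 * a2 - a0 * a0)
         + a0 ^+ 3) by rewrite /a0 /a1 /a2 => u; ring.
apply: mulr_gt0 => //; rewrite ltr_wpDl ?exprn_gt0 //.
by rewrite -mulrDr mulr_ge0 //; lra.
Qed.

End QuotientSequences.

(** * Factorial form of [g] and its quotients *)

Lemma ffactr_nat (R : realFieldType) (n m : nat) :
  ffactr (n%:R : R) m = (n ^_ m)%:R.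
Proof.
rewrite /ffactr; elim: m => [|m IHm]; first by rewrite big_ord0.
rewrite big_ord_recr /= IHm ffactnSr natrM.
case: (leqP m n) => [le_mn|lt_nm]; first by rewrite natrB.
by rewrite ffact_small // !mul0r.
Qed.

Lemma fact_neq0 (R : realFieldType) (n : nat) : (n`!)%:R != 0 :> R.
Proof. by rewrite pnatr_eq0 -lt0n fact_gt0. Qed.

Lemma ffactr_fact (R : realFieldType) (n m : nat) : (m <= n)%N ->
  ffactr (n%:R : R) m = (n`!)%:R / ((n - m)`!)%:R.
Proof.
by move=> le_mn; rewrite ffactr_nat -(ffact_fact le_mn) natrM mulfK ?fact_neq0.
Qed.

(** Writing [l = k + 3 * j] turns every descending power into a quotient of factorials without
    subtraction; the smallest one is [k]!. *)
Lemma g_fact (R : realFieldType) (k j : nat) :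
  g R (k + 3 * j) j =
    ((k + 4 * j)`!)%:R ^+ 3 * (k`!)%:R
    / (((k + 2 * j)`!)%:R ^+ 3 * ((k + 6 * j)`!)%:R).
Proof.
rewrite /g -!natrD -natrB; last by lia.
rewrite !ffactr_fact; try lia.
have -> : (k + 3 * j + j - 2 * j = k + 2 * j)%N by lia.
have -> : (k + 3 * j + 3 * j - 2 * j = k + 4 * j)%N by lia.
have -> : (k + 3 * j - j - 2 * j = k)%N by lia.
have -> : (k + 3 * j + j = k + 4 * j)%N by lia.
have -> : (k + 3 * j + 3 * j = k + 6 * j)%N by lia.
have -> : (k + 3 * j - j = k + 2 * j)%N by lia.
by field; rewrite !fact_neq0.
Qed.

(* The factor of the header with [c = e + 1]. *)
Definition gfactor (R : realFieldType) (l c j : nat) : R :=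
  1 + ((2 * j + c) * (4 * j + c + 1))%:R
      / ((l + 3 * j + c + 1)%:R * (l%:R - (3 * j + c)%:R)).

Definition gquot (R : realFieldType) (l j : nat) : R :=
  gfactor R l 0 j * gfactor R l 1 j * gfactor R l 2 j.

Lemma g_step (R : realFieldType) (l j : nat) : (3 * j.+1 <= l)%N ->
  g R l j.+1 = g R l j * gquot R l j.
Proof.
move=> /subnK; set k := (l - _)%N => <-.
rewrite g_fact.
(* With [l] fixed, lowering the index by one raises [k] by three. *)
have {1}-> : (k + 3 * j.+1 = k.+3 + 3 * j)%N by lia.
rewrite g_fact /gquot /gfactor.
have -> : (k + 4 * j.+1 = (k + 4 * j).+4)%N by lia.
have -> : (k + 2 * j.+1 = (k + 2 * j).+2)%N by lia.
have -> : (k + 6 * j.+1 = (k + 6 * j).+3.+3)%N by lia.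
rewrite !addSn !factS.
have k_ge0 : 0 <= k%:R :> R := ler0n _ _.
have j_ge0 : 0 <= j%:R :> R := ler0n _ _.
field.
by rewrite !fact_neq0 /=; do ?[apply/andP; split] => //; rewrite gt_eqF //; lra.
Qed.

(** * Growth and convexity of the quotients of [g] *)

Lemma gfactor_convex3 (R : realFieldType) (l c j : nat) :
  (3 * j.+2 + c < l)%N ->
  convex3 R (gfactor R l c j) (gfactor R l c j.+1) (gfactor R l c j.+2).
Proof.
move=> lt_l; apply/convex3D1/convex3M.
  (* The numerator is quadratic in [j] with second difference 16. *)
  by split; rewrite -?natrM -?natrD ?ler_nat //; lia.
have lt_lR : (3 * j.+2 + c)%:R < l%:R :> R by rewrite ltr_nat.
have j_ge0 : 0 <= j%:R :> R := ler0n _ _.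
have c_ge0 : 0 <= c%:R :> R := ler0n _ _.
move: lt_lR; rewrite !(natrD, natrM) -!natr1 => lt_lR.
(* With [m = 3j + c] the denominator is [l(l+1) - m(m+1)], which decreases and has second difference
   -18. *)
by apply: convex3V; rewrite ?mulr_gt0 //; nra.
Qed.

Lemma gfactor_ge1 (R : realFieldType) (l c j : nat) :
  (3 * j + c < l)%N -> 1 <= gfactor R l c j.
Proof.
move=> lt_l; rewrite lerDl divr_ge0 ?ler0n // mulr_ge0 ?ler0n //.
by rewrite subr_ge0 ler_nat ltnW.
Qed.

(** At [c = j = 0] the numerator vanishes and the factor is exactly 1, hence the condition on
    [c]. *)
Lemma gfactor_gt1 (R : realFieldType) (l c j : nat) :
  (0 < c)%N -> (3 * j + c < l)%N -> 1 < gfactor R l c j.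
Proof.
move=> c_gt0 lt_l; rewrite ltrDl divr_gt0 ?ltr0n //; first by nia.
by rewrite mulr_gt0 ?ltr0n ?subr_gt0 ?ltr_nat //; lia.
Qed.

(* The denominators at [j] and [j+1] are both bounded by [l (l+1)]. *)
Lemma gfactorS_ge (R : realFieldType) (l c j : nat) :
  (3 * j.+1 + c < l)%N ->
  gfactor R l c j + (16 * j + 6 * c + 10)%:R / (l * l.+1)%:R
    <= gfactor R l c j.+1.
Proof.
move=> lt_l; rewrite /gfactor.
set D0 := (l + _ + _ + _)%:R * _; set D1 := (l + _ + _ + _)%:R * _.
have j_ge0 : 0 <= j%:R :> R := ler0n _ _.
have c_ge0 : 0 <= c%:R :> R := ler0n _ _.
have lt_lR : 3 * (j%:R + 1) + c%:R < l%:R :> R.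
  by rewrite natr1 -natrM -natrD ltr_nat.
have D1_gt0 : 0 < D1.
  by rewrite mulr_gt0 ?ltr0n ?subr_gt0 ?ltr_nat // addn1.
have le_D10 : D1 <= D0.
  by rewrite /D0 /D1 !(natrD, natrM) -!natr1; nra.
have le_D0 : D0 <= (l * l.+1)%:R.
  by rewrite /D0 natrM -natr1 !(natrD, natrM); nra.
have D0_gt0 := lt_le_trans D1_gt0 le_D10.
(* The increment of the numerator is split off: the old part is compared over [D1 <= D0], the
   increment over [D1 <= l(l+1)]. *)
have -> : ((2 * j.+1 + c) * (4 * j.+1 + c + 1)
           = (2 * j + c) * (4 * j + c + 1) + (16 * j + 6 * c + 10))%N by lia.
rewrite -addrA lerD2l [X in _ <= X / _]natrD [leRHS]mulrDl lerD //.
  by rewrite ler_wpM2l ?ler0n // lef_pV2.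
have le_D1 := le_trans le_D10 le_D0.
by rewrite ler_wpM2l ?ler0n // lef_pV2 // posrE (lt_le_trans D1_gt0).
Qed.

Lemma gfactorS_ler (R : realFieldType) (l c j : nat) :
  (3 * j.+1 + c < l)%N -> gfactor R l c j <= gfactor R l c j.+1.
Proof.
move=> lt_l; apply: le_trans (gfactorS_ge _ _ _ _ lt_l).
by rewrite lerDl divr_ge0.
Qed.

Lemma gquot_gt1 (R : realFieldType) (l j : nat) :
  (3 * j.+1 <= l)%N -> 1 < gquot R l j.
Proof.
move=> le_l; rewrite /gquot mulrAC.
have gt1 : 1 < gfactor R l 1 j by apply: gfactor_gt1; lia.
apply: (lt_le_trans gt1); rewrite ler_peMl ?(le_trans ler01 (ltW gt1)) //.
by rewrite mulr_ege1 // gfactor_ge1 //; lia.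
Qed.

(** Only the increment of the factor [c = 2] is kept, whence [22 = 6 * 2 + 10]; the other two
    factors have a nondecreasing product that is at least 1. *)
Lemma gquotS_ge (R : realFieldType) (l j : nat) :
  (3 * j.+2 <= l)%N ->
  gquot R l j + (16 * j + 22)%:R / (l * l.+1)%:R <= gquot R l j.+1.
Proof.
move=> le_l; rewrite /gquot.
have p_ge1 c i : (c < 3)%N -> (i < j.+2)%N -> 1 <= gfactor R l c i.
  by move=> lt_c lt_i; apply: gfactor_ge1; lia.
have p_ge0 c i : (c < 3)%N -> (i < j.+2)%N -> 0 <= gfactor R l c i.
  by move=> lt_c lt_i; apply: le_trans ler01 (p_ge1 _ _ _ _).
set d := _ / _.
have d_ge0 : 0 <= d by rewrite divr_ge0.
have le_p2 : gfactor R l 2 j + d <= gfactor R l 2 j.+1.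
  by rewrite /d -[(16 * j + 22)%N]/(16 * j + (6 * 2 + 10))%N addnA;
     apply: gfactorS_ge; lia.
have p01_ge1 : 1 <= gfactor R l 0 j * gfactor R l 1 j.
  by rewrite mulr_ege1 // p_ge1.
have le_p01 : gfactor R l 0 j * gfactor R l 1 j
              <= gfactor R l 0 j.+1 * gfactor R l 1 j.+1.
  by apply: ler_pM; rewrite ?p_ge0 ?gfactorS_ler //; lia.
apply: (le_trans (y := gfactor R l 0 j * gfactor R l 1 j
                       * (gfactor R l 2 j + d))).
  by rewrite [_ * (_ + d)]mulrDr lerD2l ler_peMl.
apply: ler_pM => //; first exact: le_trans ler01 p01_ge1.
by rewrite addr_ge0 // p_ge0.
Qed.

Lemma gquotS_ler (R : realFieldType) (l j : nat) :
  (3 * j.+2 <= l)%N -> gquot R l j <= gquot R l j.+1.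
Proof.
move=> le_l; apply: le_trans (gquotS_ge _ _ _ le_l).
by rewrite lerDl divr_ge0.
Qed.

Lemma gquot_convex3 (R : realFieldType) (l j : nat) : (3 * j.+3 <= l)%N ->
  convex3 R (gquot R l j) (gquot R l j.+1) (gquot R l j.+2).
Proof. by move=> le_l; do !apply: convex3M; apply: gfactor_convex3; lia. Qed.

(** * Differences of [g] *)

Lemma g_gt0 (R : realFieldType) (l j : nat) : (3 * j <= l)%N -> 0 < g R l j.
Proof.
elim: j => [|j IHj] le_l; first by rewrite g0.
rewrite g_step // mulr_gt0 ?IHj //; first by lia.
exact: lt_trans ltr01 (gquot_gt1 _ _ _ le_l).
Qed.

Lemma g_ltS (R : realFieldType) (l j : nat) :
  (3 * j.+1 <= l)%N -> g R l j < g R l j.+1.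
Proof.
by move=> le_l; rewrite g_step // ltr_pMr ?gquot_gt1 // g_gt0 //; lia.
Qed.

Lemma Delta2_g_gt0 (R : realFieldType) (l j : nat) :
  (3 * j.+2 <= l)%N -> 0 < Delta2 (g R l) j.+1.
Proof.
move=> le_l; apply: (Delta2_quotient_gt0 _ _ (gquot R l)).
- by apply: g_gt0; lia.
- by apply: gquot_gt1; lia.
- exact: gquotS_ler.
- by apply: g_step; lia.
- exact: g_step.
Qed.

Lemma Delta3_g_gt0 (R : realFieldType) (l j : nat) :
  (3 * j.+3 <= l)%N -> 0 < Delta3 (g R l) j.+1.
Proof.
move=> le_l; have [_ le_r cvx_r] := gquot_convex3 R _ _ le_l.
apply: (Delta3_quotient_gt0 _ _ (gquot R l)) => //.
- by apply: g_gt0; lia.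
- by apply: gquot_gt1; lia.
- by apply: g_step; lia.
- by apply: g_step; lia.
- exact: g_step.
Qed.

Lemma Delta2_g1_gt (R : realFieldType) (l : nat) :
  (6 <= l)%N -> 22 / (l%:R * (l%:R + 1)) < Delta2 (g R l) 1.
Proof.
move=> l_ge6; apply: le_lt_trans (Delta2_quotient_ge _ _ (gquot R l) 0 _ _ _ _ _).
- rewrite g0 mul1r natr1 -natrM lerBrDl.
  by have := gquotS_ge R l 0; apply; lia.
- by rewrite g0.
- by apply: gquot_gt1; lia.
- by apply: gquotS_ler; lia.
- by apply: g_step; lia.
- by apply: g_step; lia.
Qed.

(** * Differences of [h] *)

Lemma hB (R : realFieldType) (l j : nat) : (j < l)%N ->
  h R l j = 2 * l%:R / (l%:R - j%:R) - 1.
Proof.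
move=> lt_jl; rewrite /h.
by field; rewrite subr_eq0 gt_eqF // ltr_nat.
Qed.

Lemma h_ltS (R : realFieldType) (l j : nat) :
  (j.+1 < l)%N -> h R l j < h R l j.+1.
Proof.
move=> lt_jl; have lt_jlR : j.+1%:R < l%:R :> R by rewrite ltr_nat.
rewrite !hB ?(ltnW lt_jl) // ltrD2r ltr_pM2l.
  rewrite ltf_pV2 ?posrE ?subr_gt0 ?ltr_nat ?(ltnW lt_jl) //.
  by rewrite ltrD2l ltrN2 ltr_nat.
by rewrite mulr_gt0 // ltr0n; lia.
Qed.

(** By [hB] this is [2l] times the second difference of the reciprocals of [x], [x+1], [x+2] with
    [x = l - (j+2)], which is [2 / (x(x+1)(x+2))]. *)
Lemma Delta2_hE (R : realFieldType) (l j : nat) : (j.+2 < l)%N ->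
  Delta2 (h R l) j.+1 = 4 * l%:R /
    ((l%:R - j.+2%:R) * (l%:R - j.+2%:R + 1) * (l%:R - j.+2%:R + 2)).
Proof.
move=> lt_jl; rewrite /Delta2 !hB; try lia.
have : j.+2%:R < l%:R :> R by rewrite ltr_nat.
rewrite -!natr1 => lt_jlR.
by field; do ?[apply/andP; split]; rewrite gt_eqF //; lra.
Qed.

Lemma Delta2_h_gt0 (R : realFieldType) (l j : nat) :
  (j.+2 < l)%N -> 0 < Delta2 (h R l) j.+1.
Proof.
move=> lt_jl; rewrite Delta2_hE //.
have x_gt0 : 0 < l%:R - j.+2%:R :> R by rewrite subr_gt0 ltr_nat.
have l_gt0 : 0 < l%:R :> R by rewrite ltr0n; lia.
move: (_ - _) x_gt0 => x x_gt0.
by rewrite divr_gt0 ?mulr_gt0 ?addr_gt0.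
Qed.

Lemma Delta3_h_gt0 (R : realFieldType) (l j : nat) :
  (j.+3 < l)%N -> 0 < Delta3 (h R l) j.+1.
Proof.
move=> lt_jl; rewrite /Delta3 !Delta2_hE ?(ltnW lt_jl) // subr_gt0.
have x_gt0 : 0 < l%:R - j.+3%:R :> R by rewrite subr_gt0 ltr_nat.
have l_gt0 : 0 < l%:R :> R by rewrite ltr0n; lia.
have -> : l%:R - j.+2%:R = l%:R - j.+3%:R + 1 :> R by rewrite -!natr1; ring.
move: (_ - _) x_gt0 => x x_gt0.
rewrite ltr_pM2l ?mulr_gt0 // ltf_pV2 ?posrE ?mulr_gt0 ?addr_gt0 //.
rewrite -subr_gt0.
have -> : (x + 1) * (x + 1 + 1) * (x + 1 + 2) - x * (x + 1) * (x + 2)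
          = 3 * ((x + 1) * (x + 2)) by ring.
by rewrite !mulr_gt0 ?addr_gt0.
Qed.

(** * Comparison of the second differences of [h] and [g] *)

Lemma Delta2_h_le (R : realFieldType) (l t : nat) : (3 * t.+2 <= l)%N ->
  Delta2 (h R l) t.+1 <= 27 / ((2 * l%:R + 3) * (l%:R + 3)).
Proof.
move=> le_l; rewrite Delta2_hE; last by lia.
have le_lR : 3 * t.+2%:R <= l%:R :> R by rewrite -natrM ler_nat.
have l_gt0 : 0 < l%:R :> R by rewrite ltr0n; lia.
(* Since [t + 2 <= l/3], the smallest factor [l - (t+2)] of the denominator is at least [2l/3]. *)
set y : R := 2 * l%:R / 3.
have y_gt0 : 0 < y by rewrite /y; lra.
have le_yx : y <= l%:R - t.+2%:R by rewrite /y; lra.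
have -> : 27 / ((2 * l%:R + 3) * (l%:R + 3))
          = 4 * l%:R / (y * (y + 1) * (y + 2)) :> R.
  by rewrite /y; field; do ?[apply/andP; split]; rewrite gt_eqF //; lra.
move: y (_ - _) y_gt0 le_yx => {}y x y_gt0 le_yx; have x_gt0 := lt_le_trans y_gt0 le_yx.
rewrite ler_pM2l ?mulr_gt0 // lef_pV2 ?posrE ?mulr_gt0 ?addr_gt0 //.
by apply: ler_pM; [apply: mulr_ge0 | | apply: ler_pM |]; lra.
Qed.

Lemma Delta2_h_lt_Delta2_g (R : realFieldType) (l t : nat) :
  (3 * t.+2 <= l)%N -> Delta2 (h R l) t.+1 < Delta2 (g R l) 1.
Proof.
move=> le_l; apply: le_lt_trans (Delta2_h_le _ _ _ le_l) _.
apply: lt_trans (Delta2_g1_gt _ _ _); last by lia.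
have l_gt0 : 0 < l%:R :> R by rewrite ltr0n; lia.
rewrite ltr_pdivrMr ?mulr_gt0 ?addr_gt0 ?mulr_gt0 //.
rewrite mulrAC ltr_pdivlMr ?mulr_gt0 ?addr_gt0 //.
(* The inequality [27 l(l+1) < 22 (2l+3)(l+3)] holds coefficientwise. *)
nra.
Qed.

Theorem theorem1p1 (R : realFieldType) (l tau : nat)
    (hl : (6 <= l)%N) (htau : tau = (l %/ 3)%N) :
  (increasing_upto tau (h R l) /\
     forall j : nat, (1 <= j <= tau - 1)%N -> 0 < Delta2 (h R l) j) /\
  (forall j : nat, (1 <= j <= tau - 2)%N -> 0 < Delta3 (h R l) j) /\
  (increasing_upto tau (g R l) /\
     forall j : nat, (1 <= j <= tau - 1)%N -> 0 < Delta2 (g R l) j) /\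
  (forall j : nat, (1 <= j <= tau - 2)%N -> 0 < Delta3 (g R l) j) /\
  Delta2 (h R l) (tau - 1) < Delta2 (g R l) 1.
Proof.
have le3 : (3 * tau <= l)%N by rewrite htau; lia.
(* This makes [tau - 1] at least 1, so that [Delta2] there is a genuine central difference. *)
have tau_ge2 : (2 <= tau)%N by rewrite htau; lia.
split; [split|split; [|split; [split|split]]].
- by apply: increasing_upto_step => j lt_j; apply: h_ltS; lia.
- by case=> // j lt_j; apply: Delta2_h_gt0; lia.
- by case=> // j lt_j; apply: Delta3_h_gt0; lia.
- by apply: increasing_upto_step => j lt_j; apply: g_ltS; lia.
- by case=> // j lt_j; apply: Delta2_g_gt0; lia.
- by case=> // j lt_j; apply: Delta3_g_gt0; lia.
case: tau tau_ge2 le3 {htau} => [|[|t]] // _ le3.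
by rewrite subSS subn0; apply: Delta2_h_lt_Delta2_g.
Qed.
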